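(* Let $X$ be a complex Banach space, let $E \subset X'$ be a closed, almost norming vector subspace of the dual space $X'$, and let $T$ be a bounded linear operator on $X$. Suppose that for all $x \in X$ and $x' \in E$ there is a $p \in [1,\infty)$ (possibly depending on $x$ and $x'$) such that $(\langle x', T^n x\rangle)_{n \in \mathbb{N}_0} \in l^p$. Then the spectral radius of $T$ satisfies $r(T) < 1$.
   Context: $X'$ is the space of all bounded linear functionals on $X$. A vector subspace $E \subset X'$ is called almost norming if there is a constant $C > 0$ such that $\|x\| \le \sup_{x' \in E,\, \|x'\| \le 1} C\,|\langle x', x\rangle|$ for all $x \in X$. For $1 \le p < \infty$, $l^p = l^p(\mathbb{N}_0;\mathbb{C})$ is the space of complex $p$-summable sequences indexed by $\mathbb{N}_0$. *)

(* Defs.v *)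
From HB Require Import structures.
From mathcomp Require Export all_boot all_order all_algebra.
From mathcomp Require Export complex.
From mathcomp Require Export all_classical all_reals all_analysis.
Export Order.TTheory GRing.Theory Num.Theory.
Export numFieldNormedType.Exports.

Set Implicit Arguments.
Unset Strict Implicit.
Unset Printing Implicit Defensive.

Local Open Scope classical_set_scope.
Local Open Scope complex_scope.
Local Open Scope ring_scope.

(* A complex Banach space is a [completeNormedModType R[i]], and its norm
   [`|x|] takes values in [R[i]], where it is a nonnegative real; [rnorm x]
   is the same number seen in [R]. On [V := R[i]] this is the modulus. *)
Definition rnorm (R : realType) (V : normedZmodType R[i]) (x : V) : R :=
  complex.Re `|x|.

Definition bounded_map (R : realType) (V W : normedZmodType R[i])
    (f : V -> W) : Prop :=
  exists M : R, forall x : V, rnorm (f x) <= M * rnorm x.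

Definition opnorm (R : realType) (V W : normedZmodType R[i])
    (f : V -> W) : \bar R :=
  ereal_sup [set (rnorm (f x))%:E | x in [set x : V | rnorm x <= 1]].

Definition dual_space (R : realType) (X : normedModType R[i]) : set (X -> R[i]) :=
  [set f | scalar f /\ bounded_map f].
Arguments dual_space {R} X _.

Definition vector_subspace (R : realType) (X : normedModType R[i])
    (E : set (X -> R[i])) : Prop :=
  [/\ E `<=` dual_space X, E (fun=> 0) &
      forall (a : R[i]) (f g : X -> R[i]),
        E f -> E g -> E (fun x => a * f x + g x)].

(* Closedness with respect to the norm of the dual space. *)
Definition dual_closed (R : realType) (X : normedModType R[i])
    (E : set (X -> R[i])) : Prop :=
  forall f, dual_space X f ->
    (forall e : R, 0 < e ->
       exists2 g, E g & (opnorm (fun x => f x - g x)%R < e%:E)%E) ->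
    E f.

Definition almost_norming (R : realType) (X : normedModType R[i])
    (E : set (X -> R[i])) : Prop :=
  exists2 C : R, 0 < C & forall x : X,
    ((rnorm x)%:E <=
       ereal_sup [set (C * rnorm (f x))%:E
                 | f in [set f | E f /\ (opnorm f <= 1)%E]])%E.

Definition in_lp (R : realType) (p : R) (a : nat -> R[i]) : Prop :=
  (\sum_(0 <= n <oo) (rnorm (a n) `^ p)%:E < +oo)%E.

Definition resolvent_set (R : realType) (X : normedModType R[i])
    (T : X -> X) : set R[i] :=
  [set l | exists S : {linear X -> X},
     [/\ bounded_map S,
         forall x, S (l *: x - T x) = x &
         forall x, l *: S x - T (S x) = x]].

Definition spectrum (R : realType) (X : normedModType R[i])
    (T : X -> X) : set R[i] := ~` resolvent_set T.

(* The supremum is taken in [\bar R]; it is [-oo] exactly when the spectrum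
   is empty, that is, for bounded [T], when [X] is the zero space. *)
Definition spectral_radius (R : realType) (X : normedModType R[i])
    (T : X -> X) : \bar R :=
  ereal_sup [set (rnorm l)%:E | l in spectrum T].

(* Main.v *)
(* By Baire's theorem on X x E, the l^p-norms of (f (T^n x))_n are bounded
   uniformly in f and x in the unit balls, for one fixed integer exponent k.
   As E is almost norming, T is power bounded. If |l| >= 1 and l x - T x is
   small for a unit vector x, then |f (T^n x)| stays bounded away from 0 for
   n < N and some f in the unit ball of E, which contradicts the uniform bound
   once N is large. So l - T is bounded below by a constant c that does not
   depend on l. For |l| > 1 the resolvent is a Neumann series, hence it has
   norm at most 1/c, and a perturbation of size less than c moves l strictly
   inside the unit disc. *)
From HB Require Import structures.
Require Import Defs.
From mathcomp Require Import ring lra.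

Set Implicit Arguments.
Unset Strict Implicit.
Unset Printing Implicit Defensive.

Local Open Scope classical_set_scope.
Local Open Scope complex_scope.
Local Open Scope ring_scope.

(** * Cauchy sequences with an explicit rate, and norms with real values *)

(** The rate [r] survives in the limit. Later this places the limit of the centres of nested closed
    balls in each of the balls. *)
Lemma cauchy_limit (K : numFieldType) (U : completeNormedModType K)
    (u : nat -> U) (r : nat -> K) :
  (forall n m, (n <= m)%N -> `|u m - u n| <= r n) ->
  (forall e, 0 < e -> exists n, r n < e) ->
  exists l, forall n, `|l - u n| <= r n.
Proof.
move=> ur r0; have ucvg : cvgn u.
  apply/cauchy_cvgP/cauchy_exP => e /r0[n rn].
  exists (u n); exists n => // m /= nm.
  by rewrite -ball_normE /= distrC (le_lt_trans (ur _ _ nm)).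
exists (limn u) => n; apply/ler_addgt0Pr => e e0.
have [N _ uN] := (cvgrPdist_lt _ _).1 ucvg e e0.
have := uN (maxn n N) (leq_maxr _ _); set m := maxn n N => ulm.
rewrite -(subrKA (u m)) (le_trans (ler_normD _ _))// addrC.
by rewrite lerD ?ur ?leq_maxl// ltW.
Qed.

Section rnorm_theory.
Variables (R : realType) (V : normedZmodType R[i]).
Implicit Types x y : V.

Lemma rnormE x : `|x| = (rnorm x)%:C.
Proof. by rewrite RRe_real// normr_real. Qed.

Lemma rnorm_le x (r : R) : (rnorm x <= r) = (`|x| <= r%:C).
Proof. by rewrite rnormE lecR. Qed.

Lemma rnorm_ge0 x : 0 <= rnorm x.
Proof. by rewrite -lecR -rnormE normr_ge0. Qed.

Lemma rnorm0 : rnorm (0 : V) = 0.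
Proof. by rewrite /rnorm normr0. Qed.

Lemma rnorm0_eq0 x : rnorm x = 0 -> x = 0.
Proof. by move=> x0; apply/normr0_eq0; rewrite rnormE x0. Qed.

Lemma rnorm_gt0 x : (0 < rnorm x) = (x != 0).
Proof.
rewrite lt_neqAle rnorm_ge0 andbT eq_sym; congr negb.
by apply/eqP/eqP => [/rnorm0_eq0|->]; rewrite ?rnorm0.
Qed.

Lemma rnormD x y : rnorm (x + y) <= rnorm x + rnorm y.
Proof. by rewrite rnorm_le rmorphD /= -!rnormE ler_normD. Qed.

Lemma rnormN x : rnorm (- x) = rnorm x.
Proof. by rewrite /rnorm normrN. Qed.

Lemma rnormB x y : rnorm (x - y) <= rnorm x + rnorm y.
Proof. by rewrite (le_trans (rnormD _ _))// rnormN. Qed.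

Lemma rnorm_distD x y z : rnorm (x - z) <= rnorm (x - y) + rnorm (y - z).
Proof. by rewrite -(subrKA y) rnormD. Qed.

End rnorm_theory.

Section complex_modulus.
Variable R : realType.
Implicit Types (z w : R[i]) (r : R).

Lemma rnormZ (X : normedModType R[i]) z (x : X) :
  rnorm (z *: x) = rnorm z * rnorm x.
Proof. by apply: complexI; rewrite rmorphM /= -!rnormE normrZ. Qed.

Lemma rnormM z w : rnorm (z * w) = rnorm z * rnorm w.
Proof. by apply: complexI; rewrite rmorphM /= -!rnormE normrM. Qed.

Lemma rnormV z : rnorm z^-1 = (rnorm z)^-1.
Proof. by apply: complexI; rewrite fmorphV /= -!rnormE normfV. Qed.

Lemma rnormX z n : rnorm (z ^+ n) = rnorm z ^+ n.
Proof. by apply: complexI; rewrite rmorphXn /= -!rnormE normrX. Qed.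

Lemma rnorm_real r : rnorm r%:C = `|r|.
Proof.
by apply: complexI; rewrite -rnormE normc_def /= expr0n addr0 sqrtr_sqr.
Qed.

Lemma rnorm_i : rnorm ('i%C : R[i]) = 1.
Proof. by rewrite /rnorm normc_def /= expr0n expr1n add0r sqrtr1. Qed.

Lemma rnorm_normalize (X : normedModType R[i]) (x : X) : 0 < rnorm x ->
  exists2 a : R[i], rnorm a = (rnorm x)^-1 & rnorm (a *: x) = 1.
Proof.
move=> x0; exists (rnorm x)^-1%:C.
  by rewrite rnorm_real gtr0_norm ?invr_gt0.
by rewrite rnormZ rnorm_real gtr0_norm ?invr_gt0// mulVf ?gt_eqF.
Qed.

Lemma rnorm_ge_Re z : `|complex.Re z| <= rnorm z.
Proof. by rewrite -lecR -rnormE normc_ge_Re. Qed.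

Lemma rnorm_ge_Im z : `|complex.Im z| <= rnorm z.
Proof.
rewrite -normrN -ReiNIm (le_trans (rnorm_ge_Re _))// rnormM.
by rewrite rnorm_i mulr1.
Qed.

Lemma rnorm_le_ReIm z : rnorm z <= `|complex.Re z| + `|complex.Im z|.
Proof.
rewrite [z in rnorm z]complexE (le_trans (rnormD _ _))// rnormM !rnorm_real.
by rewrite rnorm_i mul1r.
Qed.

End complex_modulus.

Lemma rnorm_cauchy_limit (R : realType) (X : completeNormedModType R[i])
    (u : nat -> X) (r : nat -> R) :
  (forall n m, (n <= m)%N -> rnorm (u m - u n) <= r n) ->
  (forall e, 0 < e -> exists n, r n < e) ->
  exists l, forall n, rnorm (l - u n) <= r n.
Proof.
move=> ur r0; have [||l lu] := @cauchy_limit R[i] X u (fun n => (r n)%:C).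
- by move=> n m nm; rewrite -rnorm_le ur.
- move=> e e0; have [|n rn] := r0 (complex.Re e).
    by move: e0; rewrite ltcE => /andP[].
  by exists n; move: e0; rewrite !ltcE /= => /andP[/eqP -> _]; rewrite eqxx.
by exists l => n; rewrite rnorm_le.
Qed.

Lemma complex_cauchy_limit (R : realType) (u : nat -> R[i]) (r : nat -> R) :
  (forall n m, (n <= m)%N -> rnorm (u m - u n) <= r n) ->
  (forall e, 0 < e -> exists n, r n < e) ->
  exists l, forall n, rnorm (l - u n) <= r n.
Proof.
move=> ur r0.
have [||a au] := @cauchy_limit R R (fun n => complex.Re (u n)) r => //.
  move=> n m nm; rewrite (le_trans _ (ur _ _ nm))//.
  rewrite -(raddfB (@complex.Re R : Rcomplex R -> R)).
  exact: rnorm_ge_Re.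
have [||b bu] := @cauchy_limit R R (fun n => complex.Im (u n)) r => //.
  move=> n m nm; rewrite (le_trans _ (ur _ _ nm))//.
  have -> : complex.Im (u m) - complex.Im (u n) = complex.Im (u m - u n).
    by case: (u m) (u n) => ? ? [].
  exact: rnorm_ge_Im.
exists (a +i* b) => n; apply/ler_addgt0Pr => e e0.
(* Adding the rates of the real and imaginary parts loses a factor 2. A detour through an index [k]
   with [r k < e / 3] restores the rate [r n], since it costs only [3 * r k]. *)
have [|k rk] := r0 (e / 3); first by rewrite divr_gt0.
have lu : rnorm (a +i* b - u k) <= r k + r k.
  rewrite (le_trans (rnorm_le_ReIm _))//.
  by case: (u k) (au k) (bu k) => ? ? /= ? ?; rewrite lerD.
have um := ur k (maxn n k) (leq_maxr _ _).
have un := ur n (maxn n k) (leq_maxl _ _).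
have := rnorm_distD (a +i* b) (u (maxn n k)) (u n).
have := rnorm_distD (a +i* b) (u k) (u (maxn n k)).
rewrite -(rnormN (u k - _)) opprB.
lra.
Qed.

Lemma expr_lt_eventually (R : realType) (a q e : R) :
  0 <= q < 1 -> 0 < e -> exists n, a * q ^+ n < e.
Proof.
move=> /andP[q0 q1] e0; have := @cvg_geometric R a q.
rewrite ger0_norm// => /(_ q1) /cvgrPdist_lt /(_ _ e0)[n _ /(_ n (leqnn n))].
by rewrite /= sub0r normrN => an; exists n; rewrite (le_lt_trans (ler_norm _)).
Qed.

(** * Neumann series and resolvents *)

Section neumann.
Variables (R : realType) (X : completeNormedModType R[i]).
Implicit Types (L T : {linear X -> X}) (l m : R[i]).

Lemma iter_linear L n a x y :
  iter n L (a *: x + y) = a *: iter n L x + iter n L y.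
Proof. by elim: n => //= n ->; rewrite linearP. Qed.

HB.instance Definition _ L n :=
  GRing.isLinear.Build R[i] X X *:%R (iter n L) (iter_linear L n).

(** The solution is the Neumann series of [y]. The factor [K] admits operators that are not
    contractions in the given norm, such as a power bounded operator divided by [l] with
    [1 < rnorm l]. *)
Lemma neumann_surj L (K q : R) :
  0 <= K -> 0 <= q < 1 ->
  (forall n x, rnorm (iter n L x) <= K * q ^+ n * rnorm x) ->
  forall y, exists x, x - L x = y.
Proof.
move=> K0 q01 Lq y; have /andP[q0 q1] := q01.
pose u n := \sum_(i < n) iter i L y.
pose B := K * rnorm y / (1 - q).
have B0 : 0 <= B by rewrite divr_ge0 ?mulr_ge0 ?rnorm_ge0// subr_ge0 ltW.
have uS n : u n.+1 = u n + iter n L y by rewrite /u big_ord_recr.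
have uL n : u n - L (u n) = y - iter n L y.
  elim: n => [|n IH]; first by rewrite /u big_ord0 linear0 !subrr.
  by rewrite uS linearD opprD addrACA IH /= addrA subrK.
(* [B] satisfies [K * q ^+ j * rnorm y = B * q ^+ j - B * q ^+ j.+1], so the bounds on the
   increments telescope. *)
have ub n k : rnorm (u (n + k)%N - u n) <= B * q ^+ n - B * q ^+ (n + k).
  elim: k => [|k IH]; first by rewrite addn0 !subrr rnorm0.
  rewrite addnS uS addrAC (le_trans (rnormD _ _))//.
  rewrite (le_trans (lerD IH (Lq _ _)))// exprS.
  rewrite le_eqVlt; apply/orP; left; apply/eqP.
  by rewrite /B; field; rewrite subr_eq0 eq_sym lt_eqF.
have [||x xu] := @rnorm_cauchy_limit R X u (fun n => B * q ^+ n).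
- move=> n m /subnKC <-; rewrite (le_trans (ub _ _))// gerBl.
  by rewrite mulr_ge0// exprn_ge0.
- by move=> e e0; exact: expr_lt_eventually.
exists x; apply/subr0_eq/rnorm0_eq0/eqP; rewrite eq_le rnorm_ge0 andbT.
(* [D * q ^+ n] collects the bounds for [x - u n], [L (x - u n)] and [iter n L y]. *)
pose D := B + K * q * B + K * rnorm y.
apply/ler_addgt0Pr => e e0; rewrite add0r.
have [n Dn] := expr_lt_eventually D q01 e0.
have -> : x - L x - y = (x - u n) - L (x - u n) - iter n L y.
  have -> : iter n L y = y - (u n - L (u n)) by rewrite uL subKr.
  rewrite linearB !opprB addrA; congr (_ - y).
  by rewrite -addrA [_ - L x + _]addrC !subrKA.
have Kq0 : 0 <= K * q by rewrite mulr_ge0.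
have := ler_wpM2l Kq0 (xu n).
have := Lq 1%N (x - u n); rewrite /= expr1.
have := Lq n y; have := xu n.
have := rnormB (x - u n - L (x - u n)) (iter n L y).
have := rnormB (x - u n) (L (x - u n)).
rewrite /D in Dn; move: Dn; lra.
Qed.

(** The lower bound gives injectivity and bounds the inverse by [c^-1]. The inverse is obtained by
    choice, and injectivity makes it linear. *)
Lemma resolvent_of_surj_lower_bound T l (c : R) :
  0 < c -> (forall x, c * rnorm x <= rnorm (l *: x - T x)) ->
  (forall y, exists x, l *: x - T x = y) -> resolvent_set T l.
Proof.
move=> c0 Tc Tsurj.
have inj x y : l *: x - T x = l *: y - T y -> x = y.
  move=> xy; apply/subr0_eq/rnorm0_eq0/eqP; rewrite eq_le rnorm_ge0 andbT.
  have := Tc (x - y); rewrite scalerBr (linearB T) opprB [T y - _]addrC addrACA.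
  by rewrite xy [- _ + T y]addrC -[T y - _]opprB subrr rnorm0 pmulr_rle0.
have [S ST] := choice Tsurj.
have Slin : linear S.
  move=> a x y; apply: inj; rewrite ST (linearP T) scalerDr opprD addrACA ST.
  by rewrite scalerA mulrC -scalerA -scalerBr ST.
pose SL : {linear X -> X} := HB.pack S (GRing.isLinear.Build _ _ _ _ S Slin).
exists SL; split => /=.
- exists c^-1 => x; rewrite -ler_pdivrMl ?invr_gt0// invrK.
  by rewrite (le_trans (Tc _))// ST.
- by move=> x; apply: inj; rewrite ST.
- by [].
Qed.

Lemma resolvent_power_bounded T l (K c : R) :
  0 <= K -> (forall n x, rnorm (iter n T x) <= K * rnorm x) ->
  1 < rnorm l -> 0 < c -> (forall x, c * rnorm x <= rnorm (l *: x - T x)) ->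
  resolvent_set T l.
Proof.
move=> K0 TK l1 c0 Tc; apply: (resolvent_of_surj_lower_bound c0 Tc) => y.
have ln0 : 0 < rnorm l by rewrite (lt_trans _ l1).
have l0 : l != 0 by apply: contraTneq ln0 => ->; rewrite rnorm0 ltxx.
have iterE n x : iter n (l^-1 \*: T) x = l^-1 ^+ n *: iter n T x.
  elim: n => [|n IH]; first by rewrite expr0 scale1r.
  by rewrite !iterS IH /= linearZ /= scalerA exprS.
have [|||x xE] :=
  @neumann_surj (l^-1 \*: T) K (rnorm l)^-1 _ _ _ (l^-1 *: y) => //.
- by rewrite invr_ge0 ltW//= invf_lt1.
- move=> n x; rewrite iterE rnormZ rnormX rnormV mulrAC mulrC.
  by rewrite ler_wpM2r// exprn_ge0// invr_ge0 ltW.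
exists x; have := congr1 (fun z => l *: z) xE.
by rewrite /= scalerBr !scalerA divff// !scale1r.
Qed.

(** The equation for [m] becomes [x - (l - m) *: S x = S y]. The lower bound at [l] makes the norm
    of [S] at most [c^-1], so the Neumann series converges with ratio [rnorm (l - m) / c]. *)
Lemma resolvent_perturbation T l m (c : R) :
  0 < c -> (forall x, c * rnorm x <= rnorm (l *: x - T x)) ->
  resolvent_set T l -> rnorm (l - m) < c -> resolvent_set T m.
Proof.
move=> c0 Tc [S [_ ST TS]] lm.
have Sc x : rnorm (S x) <= c^-1 * rnorm x.
  by rewrite ler_pdivlMl// (le_trans (Tc _))// TS.
pose d := c - rnorm (l - m); have d0 : 0 < d by rewrite subr_gt0.
have split x : m *: x - T x = (l *: x - T x) - (l - m) *: x.
  by rewrite scalerBl opprB [RHS]addrC subrKA.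
apply: (resolvent_of_surj_lower_bound d0) => [x|y].
  have := rnormD (m *: x - T x) ((l - m) *: x).
  by rewrite {1}split subrK rnormZ mulrBl; have := Tc x; lra.
pose L : {linear X -> X} := (l - m) \*: S.
pose q := rnorm (l - m) / c.
have q0 : 0 <= q by rewrite divr_ge0 ?rnorm_ge0 ?ltW.
have [|||x xE] := @neumann_surj L 1 q _ _ _ (S y) => //.
- by rewrite q0 ltr_pdivrMr// mul1r.
- elim=> [|n IH] x; first by rewrite expr0 !mul1r.
  rewrite iterS /= rnormZ exprS; have := ler_wpM2l q0 (IH x).
  rewrite !mul1r mulrA; apply: le_trans.
  by rewrite /q -mulrA ler_wpM2l ?rnorm_ge0.
have {}xE : x = S ((l - m) *: x + y)
  by rewrite (linearP S) -xE addrC subrK.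
by exists x; rewrite split [in l *: x - T x]xE TS addrC addKr.
Qed.

End neumann.

(** * From a uniform weak bound to power boundedness and a lower bound *)

Section weak_bound.
Variables (R : realType) (X : completeNormedModType R[i]).
Variables (E : set (X -> R[i])) (T : {linear X -> X}).
Implicit Types (f g : X -> R[i]) (x y : X).

(** A norm bound in real form, which also serves for differences of functionals given as plain
    functions. *)
Definition lip_bound f (r : R) := forall x, rnorm (f x) <= r * rnorm x.

Lemma scalar_bundle f : scalar f -> exists F : {scalar X}, f = F.
Proof.
move=> flin.
pose F : {scalar X} := HB.pack f (GRing.isLinear.Build _ _ _ _ f flin).
by exists F.
Qed.

Lemma opnorm_le1_lip f : scalar f -> (opnorm f <= 1)%E -> lip_bound f 1.
Proof.
move=> /scalar_bundle[F ->] f1 x; rewrite mul1r.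
have [->|] := eqVneq x 0; first by rewrite (linear0 F) !rnorm0.
rewrite -rnorm_gt0 => x0; have [a na ax] := rnorm_normalize x0.
have : ((rnorm (F (a *: x)))%:E <= 1)%E.
  apply: le_trans f1; apply: ereal_sup_ubound.
  by exists (a *: x) => //=; rewrite ax.
by rewrite lee_fin linearZ /= rnormM na ler_pdivrMl ?mulr1.
Qed.

(** Doubling the constant leaves a strict gap below the supremum when [x] is nonzero, so a single
    functional suffices. *)
Lemma almost_norming_attained : vector_subspace E -> almost_norming E ->
  exists2 C : R, 0 < C &
    forall x, exists f, [/\ E f, lip_bound f 1 & rnorm x <= C * rnorm (f x)].
Proof.
move=> [EX E0 _] [C C0 EC]; exists (2 * C); first by rewrite mulr_gt0.
move=> x; have [->|] := eqVneq x 0.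
  exists (fun=> 0); split => // [y|]; last by rewrite !rnorm0 mulr0.
  by rewrite rnorm0 mul1r rnorm_ge0.
rewrite -rnorm_gt0 => x0.
have : ((rnorm x / 2)%:E < ereal_sup [set (C * rnorm (f x))%:E
                 | f in [set f | E f /\ (opnorm f <= 1)%E]])%E.
  by apply: lt_le_trans (EC x); rewrite lte_fin ltr_pdivrMr// ltr_pMr// ltr1n.
move=> /ereal_sup_gt[_ [f [Ef f1] <-]]; rewrite lte_fin => xf.
exists f; split => //; first by apply: opnorm_le1_lip f1; case: (EX _ Ef).
by move: xf; lra.
Qed.

Variables (C M : R) (k : nat).
Hypothesis C0 : 0 < C.
Hypothesis k0 : (0 < k)%N.
Hypothesis EX : E `<=` dual_space X.
Hypothesis EC : forall x, exists f,
  [/\ E f, lip_bound f 1 & rnorm x <= C * rnorm (f x)].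
Hypothesis EM : forall f x (N : nat), E f -> lip_bound f 1 -> rnorm x <= 1 ->
  \sum_(n < N) rnorm (f (iter n T x)) ^+ k <= M.

Lemma weak_bound_ge0 : 0 <= M.
Proof.
have [f [Ef f1 _]] := EC 0.
by have := @EM f 0 0 Ef f1; rewrite rnorm0 big_ord0 ler01 => /(_ isT).
Qed.

(** Each summand [t ^+ k] is at most [M]. As [k] is positive, either [t <= 1] or [t <= t ^+ k],
    hence [t <= 1 + M] without taking roots. *)
Lemma weak_power_bounded n x : rnorm (iter n T x) <= C * (1 + M) * rnorm x.
Proof.
have M0 := weak_bound_ge0.
have unit_ball y : rnorm y <= 1 -> rnorm (iter n T y) <= C * (1 + M).
  move=> y1; have [f [Ef f1 fy]] := EC (iter n T y).
  apply: (le_trans fy); rewrite ler_pM2l//.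
  have := EM n.+1 Ef f1 y1; rewrite big_ord_recr /= => S.
  have {S} : rnorm (f (iter n T y)) ^+ k <= M.
    apply: le_trans S; rewrite lerDr sumr_ge0// => i _.
    by rewrite exprn_ge0 ?rnorm_ge0.
  case: (lerP (rnorm (f (iter n T y))) 1) => [f1' _|f1' /=].
    by rewrite (le_trans f1')// lerDl.
  by have := ler_eXnr k0 (ltW f1'); lra.
have [->|] := eqVneq x 0.
  by rewrite (linear0 (iter n T)) !rnorm0 mulr0.
rewrite -rnorm_gt0 => x0; have [a na ax] := rnorm_normalize x0.
have := unit_ball (a *: x); rewrite ax => /(_ (lexx _)).
by rewrite linearZ /= rnormZ na ler_pdivrMl// mulrC.
Qed.

(** Along an approximate eigenvector, the main term [l ^+ n *: x] and the error made by using it for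
    [iter n T x] both scale with [rnorm l ^+ n]. This is why [c] can be chosen independently of
    [l]. *)
Lemma weak_lower_bound : exists2 c : R, 0 < c &
  forall l x, 1 <= rnorm l -> c * rnorm x <= rnorm (l *: x - T x).
Proof.
have M0 := weak_bound_ge0; pose K := C * (1 + M).
have K0 : 0 < K by rewrite mulr_gt0// ltr_wpDr.
(* In the induction each step adds one term [K * rnorm (l *: x - T x)], which is absorbed because
   [1 <= rnorm l ^+ n.+1]. *)
have dist l n x : 1 <= rnorm l -> rnorm (l ^+ n *: x - iter n T x) <=
    n%:R * rnorm l ^+ n * (K * rnorm (l *: x - T x)).
  move=> l1; elim: n => [|n IH].
    by rewrite expr0 scale1r subrr rnorm0 !mul0r.
  have -> : l ^+ n.+1 *: x - iter n.+1 T x =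
      l *: (l ^+ n *: x - iter n T x) + iter n T (l *: x - T x).
    rewrite (linearB (iter n T)) linearZ /= -iterSr iterS.
    by rewrite scalerBr scalerA -exprS addrA subrK.
  have := weak_power_bounded n (l *: x - T x); rewrite -/K => TK.
  apply: le_trans (rnormD _ _) _; rewrite rnormZ.
  apply: le_trans (lerD (ler_wpM2l (rnorm_ge0 _) IH) TK) _.
  rewrite -natr1 exprS.
  have := exprn_ege1 n.+1 l1; rewrite exprS.
  have : 0 <= K * rnorm (l *: x - T x) by rewrite mulr_ge0 ?rnorm_ge0// ltW.
  by nra.
(* [N] values of modulus at least [(2 * C)^-1] have [k]-th powers that sum to more than [M]. *)
have [N NM] : exists N : nat, M < N%:R * (2 * C)^-1 ^+ k.
  have d0 : 0 < (2 * C)^-1 ^+ k by rewrite exprn_gt0// invr_gt0 mulr_gt0.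
  exists (Num.truncn (M / (2 * C)^-1 ^+ k)).+1.
  by rewrite -ltr_pdivrMr// truncnS_gt.
have N0 : 0 < (N%:R : R).
  by case: (N) NM => [|j _]; [rewrite mul0r; lra|exact: ltr0Sn].
(* Below this constant the relative error for [n < N] is at most [(2 * C)^-1], half of the lower
   bound [C^-1] for [rnorm (f y)] at a unit vector [y]. *)
exists (2 * C * N%:R * K)^-1; first by rewrite invr_gt0 mulr_gt0// !mulr_gt0.
move=> l; suff unit_sphere y : rnorm y = 1 -> 1 <= rnorm l ->
    (2 * C * N%:R * K)^-1 <= rnorm (l *: y - T y).
  move=> x l1; have [->|] := eqVneq x 0.
    by rewrite rnorm0 mulr0 rnorm_ge0.
  rewrite -rnorm_gt0 => x0; have [a na ax] := rnorm_normalize x0.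
  have := unit_sphere _ ax l1; rewrite 2!linearZ /=.
  by rewrite -scalerBr rnormZ na ler_pdivlMl// mulrC.
move=> y1 l1; rewrite leNgt; apply/negP => lT.
have [f [Ef f1 fy]] := EC y.
have [/scalar_bundle[F fF] _] := EX Ef.
have := EM N Ef f1; move=> /(_ y); rewrite y1 => /(_ (lexx _)).
apply/negP; rewrite -ltNge (lt_le_trans NM)//.
rewrite mulr_natl -[X in _ *+ X]card_ord -sumr_const ler_sum// => n _.
rewrite lerXn2r ?nnegrE ?rnorm_ge0//; first by rewrite invr_ge0 mulr_ge0// ltW.
have ln1 : 1 <= rnorm l ^+ n by exact: exprn_ege1.
have : rnorm (F (l ^+ n *: y)) <=
    rnorm (l ^+ n *: y - iter n T y) + rnorm (F (iter n T y)).
  have := f1 (l ^+ n *: y - iter n T y); rewrite mul1r fF linearB.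
  have := rnormD (F (l ^+ n *: y) - F (iter n T y)) (F (iter n T y)).
  by rewrite subrK; lra.
rewrite linearZ /= rnormM rnormX -fF => lower.
have := dist l n y l1.
have nN : (n%:R : R) <= N%:R by rewrite ler_nat ltnW.
have nD : n%:R * (K * rnorm (l *: y - T y)) <= (2 * C)^-1.
  have D0 : 0 <= K * rnorm (l *: y - T y) by rewrite mulr_ge0 ?rnorm_ge0// ltW.
  apply: le_trans (ler_wpM2r D0 nN) _.
  rewrite mulrA mulrC -ler_pdivlMr; last exact: mulr_gt0.
  by rewrite -invfM mulrA ltW.
have fy' : 2 * (2 * C)^-1 <= rnorm (f y).
  by rewrite invfM mulrA divff// mul1r -[_^-1]mulr1 ler_pdivrMl// -y1.
have h0 : 0 <= (2 * C)^-1 by rewrite invr_ge0 mulr_ge0// ltW.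
have : rnorm l ^+ n * (n%:R * (K * rnorm (l *: y - T y)) + (2 * C)^-1) <=
    rnorm l ^+ n * rnorm (f y) by rewrite ler_pM2l ?(lt_le_trans ltr01)//; lra.
have := ler_wpM2r h0 ln1.
by move: lower; rewrite mulrDr mulrA [rnorm l ^+ n * n%:R]mulrC; lra.
Qed.

End weak_bound.

(** * Baire's theorem for pairs of a vector and a functional in [E] *)

Lemma le0_vanishing (R : realType) (r : nat -> R) (a B : R) :
  (forall e, 0 < e -> exists n, r n < e) -> 0 <= B ->
  (forall n, a <= B * r n) -> a <= 0.
Proof.
move=> r0 B0 aB; apply/ler_addgt0Pr => e e0; rewrite add0r.
have B1 : 0 < B + 1 by rewrite ltr_wpDl.
have [|n] := r0 (e / (B + 1)); first exact: divr_gt0.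
rewrite ltr_pdivlMr// => rn; rewrite (le_trans (aB n))//.
have [rn0|rn0] := lerP 0 (r n); first by lra.
by rewrite (@le_trans _ _ 0)// ?(ltW e0)// mulr_ge0_le0// ltW.
Qed.

Section baire.
Variables (R : realType) (X : completeNormedModType R[i]).
Variable E : set (X -> R[i]).
Implicit Types (f g : X -> R[i]) (x y : X) (r : R).

(** The closed ball about [(x, f)] in the product of [X] and [E], for the maximum of the two
    norms. *)
Definition pair_ball x f r y g :=
  [/\ E g, rnorm (y - x) <= r & lip_bound (fun z => g z - f z) r].

Hypotheses (E_subspace : vector_subspace E) (E_closed : dual_closed E).

(** Completeness of [E]: pointwise limits exist at the rate [r n * rnorm z], so the limit is a
    bounded functional and a limit in norm, and closedness puts it in [E]. *)
Lemma dual_cauchy_limit (f : nat -> X -> R[i]) (r : nat -> R) :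
  (forall n, E (f n)) -> (forall n, 0 <= r n) ->
  (forall n m, (n <= m)%N -> lip_bound (fun z => f m z - f n z) (r n)) ->
  (forall e, 0 < e -> exists n, r n < e) ->
  exists2 g, E g & forall n, lip_bound (fun z => g z - f n z) (r n).
Proof.
move=> Ef rge0 fr r0; have [EX _ _] := E_subspace.
have /choice[g gf] z : exists w, forall n, rnorm (w - f n z) <= r n * rnorm z.
  apply: (@complex_cauchy_limit _ (f^~ z) (fun n => r n * rnorm z))
    => [n m nm|e e0].
    exact: fr.
  have z1 : 0 < rnorm z + 1 by rewrite ltr_wpDl ?rnorm_ge0.
  have [|n] := r0 (e / (rnorm z + 1)); first exact: divr_gt0.
  rewrite ltr_pdivlMr// => rn; exists n.
  by have := rge0 n; lra.
exists g => [|n z]; last exact: gf.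
apply: E_closed => [|e e0]; last first.
  have [n rn] := r0 e e0; exists (f n) => //.
  apply: le_lt_trans (_ : ((r n)%:E < e%:E)%E); last by rewrite lte_fin.
  apply: ge_ereal_sup => _ [z /= z1 <-]; rewrite lee_fin.
  by apply: le_trans (gf z n) _; rewrite ler_piMr.
split; last first.
  have [_ [K fK]] := EX _ (Ef 0%N); exists (r 0%N + K) => z.
  have := rnormD (g z - f 0%N z) (f 0%N z); rewrite subrK.
  by have := gf z 0%N; have := fK z; rewrite mulrDl; lra.
move=> a x y; apply/subr0_eq/rnorm0_eq0/eqP; rewrite eq_le rnorm_ge0 andbT.
(* Since [f n] is linear, the linearity defect of [g] is at most [B * r n] for every [n], hence
   zero. *)
pose B := rnorm (a *: x + y) + rnorm a * rnorm x + rnorm y.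
apply: (@le0_vanishing _ r _ B) => // [|n].
  by rewrite !addr_ge0// ?mulr_ge0// ?rnorm_ge0.
have [flin _] := EX _ (Ef n).
have -> : g (a *: x + y) - (a * g x + g y) =
    (g (a *: x + y) - f n (a *: x + y)) - (a * (g x - f n x) + (g y - f n y)).
  by rewrite flin /=; ring.
have := gf (a *: x + y) n.
have := ler_wpM2l (rnorm_ge0 a) (gf x n); rewrite -rnormM.
have := gf y n.
have := rnormD (a * (g x - f n x)) (g y - f n y).
have := rnormB (g (a *: x + y) - f n (a *: x + y))
  (a * (g x - f n x) + (g y - f n y)).
rewrite /B; lra.
Qed.

(** The classical argument: nested closed balls whose radii at least halve, the one with index
    [k.+1] lying inside [P k]. The centres converge to the required pair. *)
Lemma baire_pair (P : nat -> X -> (X -> R[i]) -> Prop) :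
  (forall k x f, E f -> P k x f ->
     exists2 r, 0 < r & forall y g, pair_ball x f r y g -> P k y g) ->
  (forall k x f r, E f -> 0 < r ->
     exists y g, pair_ball x f r y g /\ P k y g) ->
  exists x f, E f /\ forall k, P k x f.
Proof.
move=> Popen Pdense; have [_ E0 _] := E_subspace.
(* The requirements on the current ball are premises of the conclusion, so that choice yields a
   total function; an invalid triple is returned unchanged. *)
have step (s : nat * (X * (X -> R[i]) * R)) : exists s' : X * (X -> R[i]) * R,
    let: (k, (x, f, r)) := s in let: (x', f', r') := s' in
    E f -> 0 < r ->
    [/\ pair_ball x f (r / 2) x' f', 0 < r', r' <= r / 2 &
        forall y g, pair_ball x' f' r' y g -> P k y g].
  case: s => k [[x f] r].
  have [[Ef r0]|nEr] := pselect (E f /\ 0 < r); last first.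
    by exists (x, f, r) => Ef r0; case: nEr.
  have [|x' [f' [ball' Pk]]] := Pdense k x f (r / 2) Ef; first exact: divr_gt0.
  have Ef' : E f' by case: ball'.
  have [d d0 dP] := Popen _ _ _ Ef' Pk.
  exists (x', f', Num.min d (r / 2)) => _ _; split => //.
  - by rewrite lt_min d0 divr_gt0.
  - by rewrite ge_min lexx orbT.
  move=> y g [Eg yx gf]; apply: dP; split => // [|z].
    by rewrite (le_trans yx)// ge_min lexx.
  by rewrite (le_trans (gf z))// ler_wpM2r ?rnorm_ge0// ge_min lexx.
have [F Fstep] := choice step.
pose s := fix s n := if n is m.+1 then F (m, s m) else (0, (fun=> 0), 1).
pose x n := (s n).1.1; pose f n := (s n).1.2; pose r n := (s n).2.
have sE n : (x n, f n, r n) = s n by rewrite /x /f /r; case: (s n) => -[].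
have inv n : E (f n) /\ 0 < r n.
  elim: n => [|n [Ef r0]]; first by split=> //; exact: ltr01.
  have := Fstep (n, s n); rewrite -[F (n, s n)]/(s n.+1) -!sE.
  by move=> /(_ Ef r0)[[]].
have next n : [/\ pair_ball (x n) (f n) (r n / 2) (x n.+1) (f n.+1),
    r n.+1 <= r n / 2 & forall y g,
      pair_ball (x n.+1) (f n.+1) (r n.+1) y g -> P n y g].
  have [Ef r0] := inv n; have := Fstep (n, s n).
  by rewrite -[F (n, s n)]/(s n.+1) -!sE => /(_ Ef r0)[].
(* A move of the centre is at most [r n / 2], which is at most [r n - r n.+1]; these differences
   telescope. *)
have xr n m : (n <= m)%N -> rnorm (x m - x n) <= r n - r m.
  move=> /subnKC <-; elim: (m - n)%N => [|k IH].
    by rewrite addn0 !subrr rnorm0.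
  rewrite addnS; have [[_ xk _] rk _] := next (n + k)%N.
  by have := rnorm_distD (x (n + k).+1) (x (n + k)%N) (x n); lra.
have fr n m : (n <= m)%N -> lip_bound (fun z => f m z - f n z) (r n - r m).
  move=> /subnKC <- z; elim: (m - n)%N => [|k IH].
    by rewrite addn0 !subrr rnorm0 mul0r.
  rewrite addnS; have [[_ _ fk] rk _] := next (n + k)%N.
  have := rnorm_distD (f (n + k).+1 z) (f (n + k)%N z) (f n z).
  have := ler_wpM2r (rnorm_ge0 z) rk; have := fk z; lra.
have rpow n : r n <= 1 * 2^-1 ^+ n.
  elim: n => [|n IH]; first by rewrite expr0 mulr1.
  by have [_ rn _] := next n; rewrite exprS; lra.
have r0 e : 0 < e -> exists n, r n < e.
  have h : 0 <= (2^-1 : R) < 1 by apply/andP; split; lra.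
  move=> /(expr_lt_eventually 1 h)[n ne]; exists n.
  by rewrite (le_lt_trans (rpow n)).
have [||y yx] := @rnorm_cauchy_limit R X x r => //.
  move=> n m nm; rewrite (le_trans (xr _ _ nm))// gerBl ltW//.
  by case: (inv m).
have [||||g Eg gf] := @dual_cauchy_limit f r => //.
- by move=> n; case: (inv n).
- by move=> n; case: (inv n) => _ /ltW.
- move=> n m nm z; rewrite (le_trans (fr _ _ nm z))// ler_wpM2r ?rnorm_ge0//.
  by rewrite gerBl ltW//; case: (inv m).
exists y, g; split=> // k; have [_ _] := next k; apply.
by split; [exact: Eg|exact: yx|exact: gf].
Qed.

End baire.

(** * Finite sums of powers *)

(* With K = k.+1 large, the terms |a n| / K are at most 1, so the exponent p can
   be raised to K; the resulting bound K on the sum of (|a n| / K)^K is stated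
   with denominators cleared, so that a single index k ranges over both the
   exponents and the bounds. *)
Lemma in_lp_sum_exp_bounded (R : realType) (p : R) (a : nat -> R[i]) :
  1 <= p -> in_lp p a ->
  exists k, forall N : nat,
    \sum_(n < N) rnorm (a n) ^+ k.+1 <= k.+1%:R ^+ k.+2.
Proof.
move=> p1; rewrite /in_lp; set S := (\sum_(_ <= _ <oo) _)%E => Soo.
have term0 n : (0 <= (rnorm (a n) `^ p)%:E)%E by rewrite lee_fin powR_ge0.
have S0 : (0 <= S)%E by apply: nneseries_ge0.
pose s := fine S; have SE : S = s%:E by rewrite fineK// ge0_fin_numE.
have s0 : 0 <= s by rewrite -lee_fin -SE.
have partial (N : nat) : \sum_(n < N) rnorm (a n) `^ p <= s.
  rewrite -lee_fin -SE -sumEFin.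
  rewrite -(big_mkord xpredT (fun n => (rnorm (a n) `^ p)%:E)).
  exact: nneseries_lim_ge.
(* [K] exceeds 1 and [s], hence dominates every term: a term above 1 is at most its [p]-th power. It
   exceeds [p] for raising the exponent, and [s] again for the final bound. *)
pose k := Num.truncn (1 + s + p).
have kK : 1 + s + p < k.+1%:R by exact: truncnS_gt.
exists k => N; set K : R := k.+1%:R; rewrite -/K in kK.
have K0 : 0 < K by rewrite ltr0Sn.
have aK n : rnorm (a n) <= K.
  have [a1|a1] := lerP (rnorm (a n)) 1; first by lra.
  have := le1r_powR (ltW a1) p1; have := partial n.+1; rewrite big_ord_recr /=.
  have : 0 <= \sum_(i < n) rnorm (a i) `^ p.
    by apply: sumr_ge0 => *; exact: powR_ge0.
  lra.
have powle n : rnorm (a n) ^+ k.+1 <= rnorm (a n) `^ p * K ^+ k.+1.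
  have [->|a0] := eqVneq (rnorm (a n)) 0.
    by rewrite expr0n mulr_ge0 ?powR_ge0 ?exprn_ge0// ltW.
  have {}a0 : 0 < rnorm (a n) by rewrite lt_neqAle eq_sym a0 rnorm_ge0.
  rewrite -ler_pdivrMr ?exprn_gt0// -expr_div_n.
  have aK0 : 0 < rnorm (a n) / K by rewrite divr_gt0.
  rewrite -powR_mulrn ?(ltW aK0)//.
  apply: (@le_trans _ _ ((rnorm (a n) / K) `^ p)).
    by apply: ger_powR; [rewrite aK0 /= ler_pdivrMr// mul1r aK|
                         rewrite -/K; lra].
  apply: ge0_ler_powR; rewrite ?nnegrE ?(ltW aK0) ?(ltW a0)//; first by lra.
  by rewrite ler_pdivrMr// ler_pMr//; lra.
apply: (@le_trans _ _ (\sum_(n < N) rnorm (a n) `^ p * K ^+ k.+1)).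
  by apply: ler_sum.
rewrite -mulr_suml [leRHS]exprS ler_wpM2r ?exprn_ge0 ?(ltW K0)//.
by have := partial N; lra.
Qed.

(** This supplies the openness required by the Baire argument. *)
Lemma sum_exp_lower_semicontinuous (R : realType) (k N : nat) (a : nat -> R)
    (B : R) :
  B < \sum_(n < N) a n ^+ k ->
  exists2 d, 0 < d & forall b : nat -> R,
    (forall n, (n < N)%N -> `|a n - b n| <= d) -> B < \sum_(n < N) b n ^+ k.
Proof.
elim: N B => [|N IH] B.
  by rewrite big_ord0 => B0; exists 1 => // b _; rewrite big_ord0.
rewrite big_ord_recr /=; set S := \sum_(_ < _) _ => SB.
(* Half of the slack goes to the first [N] terms, by induction, and half to the last term, by
   continuity of the power. *)
pose e := (S + a N ^+ k - B) / 2.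
have e0 : 0 < e by rewrite divr_gt0// subr_gt0.
have [|d d0 dP] := IH (S - e); first by rewrite gtrBl.
have /cvgrPdist_lt/(_ _ e0)/nbhs_ballP[d' /= d'0 d'P] :=
  @exprn_continuous R k (a N).
exists (Num.min d (d' / 2)) => [|b ab]; first by rewrite lt_min d0 divr_gt0.
have bS : S - e < \sum_(n < N) b n ^+ k.
  by apply: dP => n nN; have := ab n (ltnW nN); rewrite le_min => /andP[].
have : `|a N ^+ k - b N ^+ k| < e.
  apply: d'P; rewrite -ball_normE /=; have := ab N (ltnSn N).
  rewrite le_min => /andP[_ /le_lt_trans]; apply.
  by rewrite ltr_pdivrMr// ltr_pMr// ltr1n.
rewrite big_ord_recr /= ltr_norml => /andP[_]; move: bS; rewrite /e; lra.
Qed.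

(** [a + b] is at most twice the larger term. Summed over [n], this plays the part of Minkowski's
    inequality, up to a constant. *)
Lemma exprD_le (R : realType) (k : nat) (a b : R) :
  0 <= a -> 0 <= b -> (a + b) ^+ k <= 2 ^+ k * (a ^+ k + b ^+ k).
Proof.
move=> a0 b0; wlog ab : a b a0 b0 / a <= b.
  move=> H; case: (leP a b) => [|/ltW] ?; first exact: H.
  by rewrite addrC [a ^+ k + _]addrC; exact: H.
apply: (@le_trans _ _ ((2 * b) ^+ k)).
  by rewrite lerXn2r ?nnegrE ?addr_ge0 ?mulr_ge0//; lra.
by rewrite exprMn ler_wpM2l ?exprn_ge0// lerDr exprn_ge0.
Qed.

Lemma sum_rnorm_expB_le (R : realType) (k N : nat) (a b : nat -> R[i]) :
  \sum_(n < N) rnorm (a n - b n) ^+ k <=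
  2 ^+ k * (\sum_(n < N) rnorm (a n) ^+ k + \sum_(n < N) rnorm (b n) ^+ k).
Proof.
rewrite -big_split /= mulr_sumr; apply: ler_sum => n _.
apply: le_trans (exprD_le k (rnorm_ge0 _) (rnorm_ge0 _)).
by rewrite lerXn2r ?nnegrE ?addr_ge0 ?rnorm_ge0// rnormB.
Qed.

(** * The uniform weak bound *)

Section uniform.
Variables (R : realType) (X : completeNormedModType R[i]).
Variables (E : set (X -> R[i])) (T : {linear X -> X}).
Implicit Types (f g : X -> R[i]) (x y : X).

Definition weak_sum k N f x : R := \sum_(n < N) rnorm (f (iter n T x)) ^+ k.

Hypothesis E_subspace : vector_subspace E.
Hypothesis T_bounded : bounded_map T.

Lemma weak_sum_open k N f x (B : R) : E f -> B < weak_sum k N f x ->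
  exists2 r, 0 < r & forall y g, pair_ball E x f r y g -> B < weak_sum k N g y.
Proof.
have [EX _ _] := E_subspace.
move=> /EX[/scalar_bundle[F ->] [A FA]].
move=> /(@sum_exp_lower_semicontinuous R k N
  (fun n => rnorm (F (iter n T x)))) [d d0 dP].
have [K0 TK0] := T_bounded.
(* The constant in [bounded_map] may be negative, hence the absolute value; [1 <= K] lets [K ^+ N]
   dominate all lower powers. *)
pose K := 1 + `|K0|; have K1 : 1 <= K by rewrite lerDl.
have TK n y : (n < N)%N -> rnorm (iter n T y) <= K ^+ N * rnorm y.
  move=> nN; apply: (@le_trans _ _ (K ^+ n * rnorm y)); last first.
    by rewrite ler_wpM2r ?rnorm_ge0// ler_weXn2l// ltnW.
  elim: n {nN} => [|n IH]; first by rewrite mul1r.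
  rewrite iterS exprS -mulrA (le_trans (TK0 _))//.
  apply: le_trans (ler_wpM2l (le_trans ler01 K1) IH).
  by rewrite ler_wpM2r ?rnorm_ge0// (le_trans (ler_norm _))// lerDr.
have KN : 1 <= K ^+ N by exact: exprn_ege1.
(* The difference of the values splits into [g - F] at [iter n T y] and [F] at [iter n T (y - x)].
   For a radius [r <= 1], which gives [rnorm y <= rnorm x + 1], the two add up to at most
   [r * D]. *)
pose D := K ^+ N * (rnorm x + 1 + `|A|).
have D0 : 0 < D.
  apply: mulr_gt0; first exact: lt_le_trans KN.
  by have := rnorm_ge0 x; have := normr_ge0 A; lra.
exists (Num.min 1 (d / D)) => [|y g [_ yx gF]].
  by rewrite lt_min ltr01 divr_gt0.
move: yx gF; set r := Num.min 1 _ => yx gF.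
have r1 : r <= 1 by rewrite ge_min lexx.
have rD : r * D <= d by rewrite -ler_pdivlMr// ge_min lexx orbT.
have r0 : 0 <= r by rewrite (le_trans _ yx)// rnorm_ge0.
apply: (dP (fun n => rnorm (g (iter n T y)))) => n nN.
have dist (z w : R[i]) : `|rnorm z - rnorm w| <= rnorm (w - z).
  rewrite ler_norml; have := rnormD (w - z) z; have := rnormB w (w - z).
  by rewrite subrK opprB addrC subrK => ? ?; apply/andP; split; lra.
apply: le_trans (dist _ _) _.
have -> : g (iter n T y) - F (iter n T x) =
    (g (iter n T y) - F (iter n T y)) + F (iter n T (y - x)).
  by rewrite (linearB (iter n T)) linearB addrA subrK.
apply: le_trans (rnormD _ _) (le_trans _ rD).
have yx1 : rnorm y <= rnorm x + 1.
  by have := rnormD (y - x) x; rewrite subrK; lra.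
have := gF (iter n T y).
have := ler_wpM2l r0 (TK n y nN).
have := FA (iter n T (y - x)).
have : A * rnorm (iter n T (y - x)) <= `|A| * rnorm (iter n T (y - x)).
  by rewrite ler_wpM2r ?rnorm_ge0// ler_norm.
have := ler_wpM2l (normr_ge0 A) (TK n (y - x) nN).
have := ler_wpM2l (mulr_ge0 (normr_ge0 A) (le_trans ler01 KN)) yx.
have := ler_wpM2l (mulr_ge0 r0 (le_trans ler01 KN)) yx1.
rewrite /D; lra.
Qed.

Hypothesis E_closed : dual_closed E.
Hypothesis weak_lp : forall x f, E f ->
  exists2 p : R, 1 <= p & in_lp p (fun n => f (iter n T x)).

(** Otherwise, for every [k], the pairs with a partial sum above [k.+1%:R ^+ k.+2] form an open
    dense set. A pair common to all these sets contradicts [in_lp_sum_exp_bounded]. *)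
Lemma weak_sum_bounded_on_ball : exists k x f r B, [/\ E f, 0 < r &
  forall y g N, pair_ball E x f r y g -> weak_sum k.+1 N g y <= B].
Proof.
apply: contrapT => unbounded.
have [k x f Ef [N PN]|k x f r Ef r0|x [f [Ef Pf]]] :=
  @baire_pair R X E E_subspace E_closed
    (fun k x f => exists N, k.+1%:R ^+ k.+2 < weak_sum k.+1 N f x).
- have [r r0 rP] := weak_sum_open Ef PN; exists r => // y g yg.
  by exists N; exact: rP.
- apply: contrapT => good; apply: unbounded.
  exists k, x, f, r, (k.+1%:R ^+ k.+2); split => // y g N yg.
  rewrite leNgt; apply/negP => big; apply: good.
  by exists y, g; split => //; exists N.
have [p p1 /(in_lp_sum_exp_bounded p1)[k ak]] := weak_lp x Ef.
by have [N] := Pf k; rewrite ltNge; apply/negP; rewrite negbK; exact: ak.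
Qed.

(** The bound moves from the ball about [(x0, f0)] to the unit balls by bilinearity of the pairing.
    Scaling both [x] and [f] by [r] accounts for the factor [(r * r)^-1]. *)
Lemma uniform_weak_bound : exists k M, (0 < k)%N /\
  forall f x (N : nat), E f -> lip_bound f 1 -> rnorm x <= 1 ->
    weak_sum k N f x <= M.
Proof.
have [k [x0 [f0 [r [B [Ef0 r0 ball]]]]]] := weak_sum_bounded_on_ball.
have [EX E0 Elin] := E_subspace.
(* The nesting reflects two uses of [sum_rnorm_expB_le]: for the differences in the functional, then
   for the difference in the vector. *)
pose M := 2 ^+ k.+1 * (2 ^+ k.+1 * (B + B) + 2 ^+ k.+1 * (B + B)).
exists k.+1, ((r * r)^-1 ^+ k.+1 * M); split=> // f x N Ef f1 x1.
pose y : X := r%:C *: x; pose g z := r%:C * f z.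
have Eg : E (fun z => g z + f0 z) by exact: Elin.
have nr : rnorm (r%:C : R[i]) = r by rewrite rnorm_real gtr0_norm.
have yr : rnorm y <= r by rewrite rnormZ nr ger_pMr.
have ball_r z h : z = x0 \/ z = x0 + y -> h = f0 \/ h = (fun z => g z + f0 z) ->
    pair_ball E x0 f0 r z h.
  move=> zE hE; split.
  - by case: hE => ->.
  - case: zE => ->; first by rewrite subrr rnorm0 ltW.
    by rewrite addrAC subrr add0r.
  - move=> w; case: hE => ->.
      by rewrite subrr rnorm0 mulr_ge0 ?rnorm_ge0// ltW.
    by rewrite addrK rnormM nr ler_pM2l// (le_trans (f1 w))// mul1r.
pose h z := g z + f0 z.
pose a z n := h (iter n T z); pose b z n := f0 (iter n T z).
(* Polarization: g (T^n y) is a signed sum of the values of h and f0 on the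
   orbits of x0 + y and x0, and these pairs lie in the ball given by Baire. *)
have fE n : rnorm (f (iter n T x)) =
    (r * r)^-1 * rnorm ((a (x0 + y) n - b (x0 + y) n) - (a x0 n - b x0 n)).
  have -> : a (x0 + y) n - b (x0 + y) n - (a x0 n - b x0 n) =
      (r * r)%:C * f (iter n T x).
    have [flin _] := EX _ Ef.
    rewrite /a /b /h /g /y !addrK [x0 + _]addrC iter_linear flin /=.
    by rewrite mulrDr addrK mulrA -rmorphM.
  rewrite rnormM rnorm_real ger0_norm ?mulKf ?mulf_neq0 ?gt_eqF//.
  by rewrite mulr_ge0 ?ltW.
have small z : z = x0 \/ z = x0 + y ->
    \sum_(n < N) rnorm (a z n - b z n) ^+ k.+1 <= 2 ^+ k.+1 * (B + B).
  move=> zE; apply: le_trans (sum_rnorm_expB_le _ _ _ _) _.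
  rewrite ler_wpM2l ?exprn_ge0//; apply: lerD; apply: ball; apply: ball_r => //.
    by right.
  by left.
rewrite /weak_sum; under eq_bigr do rewrite fE exprMn.
rewrite -mulr_sumr; apply: ler_wpM2l.
  by rewrite exprn_ge0// invr_ge0 mulr_ge0// ltW.
apply: le_trans (sum_rnorm_expB_le _ _ (fun n => a (x0 + y) n - b (x0 + y) n)
  (fun n => a x0 n - b x0 n)) _.
rewrite ler_wpM2l ?exprn_ge0//; apply: lerD; apply: small; [by right|by left].
Qed.

End uniform.

(** * The bound on the spectral radius *)

Theorem corollary4p3 (R : realType) (X : completeNormedModType R[i])
  (E : set (X -> R[i])) (T : {linear X -> X})
  (E_subspace : vector_subspace E) (E_closed : dual_closed E)
  (E_norming : almost_norming E) (T_bounded : bounded_map T)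
  (weak_lp : forall (x : X) (x' : X -> R[i]), E x' ->
     exists2 p : R, 1 <= p & in_lp p (fun n => x' (iter n T x))) :
  (spectral_radius T < 1)%E.
Proof.
have [EX _ _] := E_subspace.
have [k [M [k0 EM]]] :=
  uniform_weak_bound E_subspace T_bounded E_closed weak_lp.
have [C C0 EC] := almost_norming_attained E_subspace E_norming.
have TK := weak_power_bounded C0 k0 EC EM.
have [c c0 Tc] := weak_lower_bound C0 k0 EX EC EM.
have K0 : 0 <= C * (1 + M).
  by rewrite mulr_ge0 ?(ltW C0)// addr_ge0// (weak_bound_ge0 EC EM).
(* [d <= c] leaves room for the perturbation. [d <= 1] keeps [1 - d / 2] positive, so that a point
   [m] of larger modulus is nonzero and can be rescaled. *)
pose d := Num.min c 1.
have [d0 dc d1] : [/\ 0 < d, d <= c & d <= 1].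
  by rewrite lt_min c0 ltr01 !ge_min !lexx orbT.
have out (l : R[i]) : 1 < rnorm l -> resolvent_set T l.
  move=> l1; apply: (resolvent_power_bounded K0 TK l1 c0) => x.
  exact/Tc/ltW.
apply: (@le_lt_trans _ _ (1 - d / 2)%:E); last first.
  by rewrite lte_fin gtrBl divr_gt0.
apply: ge_ereal_sup => _ [m mT <-]; rewrite lee_fin leNgt; apply/negP => dm.
apply: mT; have [m1|m1] := ltrP 1 (rnorm m); first exact: out.
have m0 : 0 < rnorm m by lra.
(* l is m rescaled to modulus 1 + d / 4, so |l - m| < 3 d / 4 < c. *)
pose t := (1 + d / 4) / rnorm m; pose l := t%:C * m.
have nl : rnorm l = 1 + d / 4.
  rewrite rnormM rnorm_real ger0_norm ?divr_ge0 ?(ltW m0)//; last by lra.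
  by rewrite divfK// gt_eqF.
have l1 : 1 < rnorm l by rewrite nl; lra.
apply: (@resolvent_perturbation _ _ T l m c) => //; [|exact: out|].
  by move=> x; exact/Tc/ltW.
have -> : l - m = (t - 1)%:C * m by rewrite rmorphB /= mulrBl mul1r.
rewrite rnormM rnorm_real ger0_norm.
  by rewrite mulrBl mul1r divfK ?gt_eqF//; lra.
by rewrite subr_ge0 ler_pdivlMr// mul1r; lra.
Qed.
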